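(* Let $A,A',B,B'$ be ideals of a Boolean ring $P$ such that $P=A\oplus B=A'\oplus B'$. Then the following are equivalent: (1) $\mathrm{B}(A,B)\cong \mathrm{B}(A',B')$ as trusses; (2) there exist $a\in A$ and $b\in B$ such that $A'\cong (1-a)A\oplus bB$ and $B'\cong aA\oplus(1-b)B$ as rings.
   Context: An Abelian heap is a set $H$ with a ternary operation $[-,-,-]$ such that for all $a_1,\dots,a_5\in H$: $[[a_1,a_2,a_3],a_4,a_5]=[a_1,a_2,[a_3,a_4,a_5]]$; $[a_1,a_2,a_2]=a_1$ and $[a_2,a_1,a_1]=a_2$; $[a_1,a_2,a_3]=[a_3,a_2,a_1]$. A truss is an Abelian heap $(T,[-,-,-])$ with an associative binary operation $\cdot$ satisfying $a\cdot[b,c,d]=[a\cdot b,a\cdot c,a\cdot d]$ and $[b,c,d]\cdot a=[b\cdot a,c\cdot a,d\cdot a]$. A truss isomorphism is a bijection preserving both operations; direct products carry componentwise operations. Rings are associative and need not be unital; a Boolean ring is a (not necessarily unital) ring in which $x^2=x$ for all $x$. $P=A\oplus B$ means that $P$ is the internal direct sum of the ideals $A$ and $B$. For a ring $R$, $\mathrm{T}(R)$ is the set $R$ with heap operation $[a,b,c]=a-b+c$ and the ring multiplication, and $\mathrm{T}(R,\circ)$ is the set $R$ with the same heap operation and multiplication $a\circ b=a+b+ab$. For ideals $A,B$ of $P$ with $P=A\oplus B$ (regarded as rings), $\mathrm{B}(A,B):=\mathrm{T}(A,\circ)\times \mathrm{T}(B)$. For $a\in A$, $aA=\{ax: x\in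 A\}$ and $(1-a)A=\{x-ax: x\in A\}$ (the ring need not contain $1$); similarly for $bB$ and $(1-b)B$ with $b\in B$. These are ideals of $P$, regarded as rings. *)

(* Defs.v *)
From HB Require Import structures.
From mathcomp Require Import all_boot ssralg.
From mathcomp Require Import boolp classical_sets.

Set Implicit Arguments.
Unset Strict Implicit.
Unset Printing Implicit Defensive.

Import GRing.Theory.
Local Open Scope classical_set_scope.
Local Open Scope ring_scope.

Reserved Notation "[<| a , b , c |>]" (at level 0, format "[<| a ,  b ,  c |>]").
Reserved Notation "x *t y" (at level 40, left associativity).
Reserved Notation "x *r y" (at level 40, left associativity).

(* The other Mal'cev identity, [b, b, a] = a, is heapK rewritten with heapC.  *)
HB.mixin Record isAbelianHeap (H : Type) := {
  heap : H -> H -> H -> H;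
  heapA : forall a b c d e : H,
    heap (heap a b c) d e = heap a b (heap c d e);
  heapK : forall a b : H, heap a b b = a;
  heapC : forall a b c : H, heap a b c = heap c b a
}.

#[short(type="abelianHeapType")]
HB.structure Definition AbelianHeap := { H of isAbelianHeap H }.

Notation "[<| a , b , c |>]" := (heap a b c).

HB.mixin Record AbelianHeap_isTruss T of AbelianHeap T := {
  tmul : T -> T -> T;
  tmulA : associative tmul;
  tmulHr : forall a b c d : T,
    tmul a [<| b, c, d |>] = [<| tmul a b, tmul a c, tmul a d |>];
  tmulHl : forall a b c d : T,
    tmul [<| b, c, d |>] a = [<| tmul b a, tmul c a, tmul d a |>]
}.

#[short(type="trussType")]
HB.structure Definition Truss := { T of AbelianHeap_isTruss T & AbelianHeap T }.

Notation "x *t y" := (tmul x y).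

Definition truss_iso (T U : trussType) : Prop :=
  exists f : T -> U,
    [/\ bijective f,
        forall a b c, f [<| a, b, c |>] = [<| f a, f b, f c |>]
      & {morph f : a b / a *t b}].

Section TrussProd.
Variables T U : trussType.
Implicit Types x y z : T * U.

Let pheap x y z : T * U := ([<| x.1, y.1, z.1 |>], [<| x.2, y.2, z.2 |>]).
Let pmul x y : T * U := (x.1 *t y.1, x.2 *t y.2).

Let pheapA a b c d e : pheap (pheap a b c) d e = pheap a b (pheap c d e).
Proof. by rewrite /pheap /= !heapA. Qed.

Let pheapK a b : pheap a b b = a.
Proof. by case: a => a1 a2; rewrite /pheap /= !heapK. Qed.

Let pheapC a b c : pheap a b c = pheap c b a.
Proof. by rewrite /pheap; congr (_, _); apply: heapC. Qed.

HB.instance Definition _ := isAbelianHeap.Build (T * U)%type pheapA pheapK pheapC.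

Let pmulA : associative pmul.
Proof. by move=> x y z; rewrite /pmul /= !tmulA. Qed.

Let pmulHr a b c d :
  pmul a [<| b, c, d |>] = [<| pmul a b, pmul a c, pmul a d |>].
Proof. by congr (_, _); apply: tmulHr. Qed.

Let pmulHl a b c d :
  pmul [<| b, c, d |>] a = [<| pmul b a, pmul c a, pmul d a |>].
Proof. by congr (_, _); apply: tmulHl. Qed.

HB.instance Definition _ :=
  AbelianHeap_isTruss.Build (T * U)%type pmulA pmulHr pmulHl.
End TrussProd.

(* Rings in the sense used here need not be unital, whereas pzRingType has a  *)
(* 1; hence a multiplication of its own, written *r.                          *)
HB.mixin Record Zmodule_isRng R of GRing.Zmodule R := {
  rmul : R -> R -> R;
  rmulA : associative rmul;
  rmulDl : left_distributive rmul +%R;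
  rmulDr : right_distributive rmul +%R
}.

#[short(type="rngType")]
HB.structure Definition Rng := { R of Zmodule_isRng R & GRing.Zmodule R }.

Notation "x *r y" := (rmul x y).

HB.mixin Record Rng_isBoolean R of Rng R := {
  rmulxx : forall x : R, x *r x = x
}.

#[short(type="boolRngType")]
HB.structure Definition BoolRng := { R of Rng_isBoolean R & Rng R }.

Section RngTheory.
Variable R : rngType.
Implicit Types x y z : R.

Lemma rmul0r x : 0 *r x = 0.
Proof. by apply: (addrI (0 *r x)); rewrite -rmulDl !addr0. Qed.

Lemma rmulr0 x : x *r 0 = 0.
Proof. by apply: (addrI (x *r 0)); rewrite -rmulDr !addr0. Qed.

Lemma rmulNr x y : (- x) *r y = - (x *r y).
Proof. by apply: (addrI (x *r y)); rewrite -rmulDl !subrr rmul0r. Qed.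

Lemma rmulrN x y : x *r (- y) = - (x *r y).
Proof. by apply: (addrI (x *r y)); rewrite -rmulDr !subrr rmulr0. Qed.

Lemma rmulBl x y z : (x - y) *r z = x *r z - y *r z.
Proof. by rewrite rmulDl rmulNr. Qed.

Lemma rmulBr x y z : x *r (y - z) = x *r y - x *r z.
Proof. by rewrite rmulDr rmulrN. Qed.
End RngTheory.

Lemma boolrng_mulC (P : boolRngType) : commutative (@rmul P).
Proof.
have dbl (x : P) : x + x = 0.
  have := rmulxx (x + x); rewrite rmulDl !rmulDr !rmulxx => dx.
  by apply: (addrI (x + x)); rewrite addr0.
move=> x y; have := rmulxx (x + y); rewrite rmulDl !rmulDr !rmulxx => h.
have xy0 : x *r y + y *r x = 0.
  apply: (addrI (x + y)); rewrite addr0 -[RHS]h !addrA.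
  by rewrite [RHS](+%R.[ACl 1 * 4 * 2 * 3]).
by apply: (addIr (y *r x)); rewrite xy0 dbl.
Qed.

Definition rng_iso (R S : rngType) : Prop :=
  exists f : R -> S,
    [/\ bijective f, {morph f : x y / x + y} & {morph f : x y / x *r y}].

(* The (external) direct sum of two rings is their product type.              *)
Section RngProd.
Variables R S : rngType.

Let pmul (x y : R * S) : R * S := (x.1 *r y.1, x.2 *r y.2).

Let pmulA : associative pmul.
Proof. by move=> x y z; rewrite /pmul /= !rmulA. Qed.

Let pmulDl : left_distributive pmul +%R.
Proof. by move=> x y z; rewrite /pmul /= !rmulDl. Qed.

Let pmulDr : right_distributive pmul +%R.
Proof. by move=> x y z; rewrite /pmul /= !rmulDr. Qed.

HB.instance Definition _ := Zmodule_isRng.Build (R * S)%type pmulA pmulDl pmulDr.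
End RngProd.

Definition trussT (R : rngType) : Type := R.

Section TrussT.
Variable R : rngType.
Implicit Types a b c d e : R.

Let h a b c : R := a - b + c.

Let hA a b c d e : h (h a b c) d e = h a b (h c d e).
Proof. by rewrite /h !addrA. Qed.

Let hK a b : h a b b = a.
Proof. exact: subrK. Qed.

Let hC a b c : h a b c = h c b a.
Proof. by rewrite /h addrAC (addrC a) addrAC. Qed.

HB.instance Definition _ := isAbelianHeap.Build (trussT R) hA hK hC.

Let mHr a b c d : a *r h b c d = h (a *r b) (a *r c) (a *r d).
Proof. by rewrite /h rmulDr rmulBr. Qed.

Let mHl a b c d : h b c d *r a = h (b *r a) (c *r a) (d *r a).
Proof. by rewrite /h rmulDl rmulBl. Qed.

HB.instance Definition _ :=
  AbelianHeap_isTruss.Build (trussT R) (@rmulA R) mHr mHl.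
End TrussT.

Definition circ (R : rngType) (a b : R) : R := a + b + a *r b.

Definition trussTcirc (R : rngType) : Type := R.

Section TrussTcirc.
Variable R : rngType.
Implicit Types a b c d : R.

HB.instance Definition _ := AbelianHeap.copy (trussTcirc R) (trussT R).

Let cA : associative (@circ R).
Proof.
move=> a b c; rewrite /circ !rmulDl !rmulDr !rmulA !addrA; congr (_ + _).
by rewrite [LHS](+%R.[ACl 1 * 2 * 5 * 3 * 6 * 4]).
Qed.

Let cHr a b c d : circ a (b - c + d) = circ a b - circ a c + circ a d.
Proof.
rewrite /circ rmulDr rmulBr !opprD !addrA.
by rewrite [RHS](+%R.[ACl 1 * 4 * 7 * 2 * 5 * 8 * 3 * 6 * 9]) /= subrK.
Qed.

Let cHl a b c d : circ (b - c + d) a = circ b a - circ c a + circ d a.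
Proof.
rewrite /circ rmulDl rmulBl !opprD !addrA.
by rewrite [RHS](+%R.[ACl 1 * 4 * 7 * 2 * 5 * 8 * 3 * 6 * 9]) /= subrK.
Qed.

HB.instance Definition _ :=
  AbelianHeap_isTruss.Build (trussTcirc R) cA cHr cHl.
End TrussTcirc.

Record ideal (R : rngType) := Ideal {
  ideal_set :> set R;
  ideal0 : ideal_set 0;
  idealB : forall x y, ideal_set x -> ideal_set y -> ideal_set (x - y);
  idealMl : forall r x, ideal_set x -> ideal_set (r *r x);
  idealMr : forall r x, ideal_set x -> ideal_set (x *r r)
}.

Definition direct_sum (R : rngType) (A B : ideal R) : Prop :=
  [set a + b | a in A & b in B] = setT /\ A `&` B = [set 0].

Definition ideal_pred (R : rngType) (A : ideal R) : {pred R} :=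
  fun x => x \in (A : set R).

(* The ideal A as a ring in its own right.                                    *)
Definition subrng (R : rngType) (A : ideal R) : Type := {x : R | ideal_pred A x}.

Section SubRng.
Variables (R : rngType) (A : ideal R).

Let zmodA : zmod_closed (ideal_pred A).
Proof.
split=> [|x y /set_mem Ax /set_mem Ay]; first exact: mem_set (ideal0 A).
exact: mem_set (idealB Ax Ay).
Qed.

HB.instance Definition _ := GRing.isZmodClosed.Build R (ideal_pred A) zmodA.

HB.instance Definition _ := [isSub of subrng A for @sval R (ideal_pred A)].
HB.instance Definition _ := [Choice of subrng A by <:].
HB.instance Definition _ := [SubChoice_isSubZmodule of subrng A by <:].

Let smulP (x y : subrng A) : ideal_pred A (val x *r val y).
Proof. exact: mem_set (idealMl (val x) (set_mem (valP y))). Qed.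

Let smul (x y : subrng A) : subrng A := Sub (val x *r val y) (smulP x y).

Let smulA : associative smul.
Proof. by move=> x y z; apply: val_inj; exact: rmulA. Qed.

Let smulDl : left_distributive smul +%R.
Proof. by move=> x y z; apply: val_inj; exact: rmulDl. Qed.

Let smulDr : right_distributive smul +%R.
Proof. by move=> x y z; apply: val_inj; exact: rmulDr. Qed.

HB.instance Definition _ := Zmodule_isRng.Build (subrng A) smulA smulDl smulDr.
End SubRng.

Definition trussB (R : rngType) (A B : ideal R) : trussType :=
  (trussTcirc (subrng A) * trussT (subrng B))%type.

(* For e in a Boolean ring P and an ideal A of P: the ideals eA and (1 - e)A. *)
(* P need not contain 1, so (1 - e)x stands for x - ex.                       *)
Section PrincipalParts.
Variables (P : boolRngType) (e : P) (A : ideal P).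

Let emul : set P := [set e *r x | x in A].

Let emul0 : emul 0.
Proof. by exists 0; [exact: ideal0 | rewrite rmulr0]. Qed.

Let emulB x y : emul x -> emul y -> emul (x - y).
Proof.
move=> [u Au <-] [v Av <-]; exists (u - v); first exact: idealB.
by rewrite rmulBr.
Qed.

Let emulMl r x : emul x -> emul (r *r x).
Proof.
move=> [u Au <-]; exists (r *r u); first exact: idealMl.
by rewrite !rmulA (boolrng_mulC e).
Qed.

Let emulMr r x : emul x -> emul (x *r r).
Proof. by rewrite boolrng_mulC; exact: emulMl. Qed.

Definition mul_ideal : ideal P := Ideal emul0 emulB emulMl emulMr.

Let cmul : set P := [set x - e *r x | x in A].

Let cmul0 : cmul 0.
Proof. by exists 0; [exact: ideal0 | rewrite rmulr0 subr0]. Qed.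

Let cmulB x y : cmul x -> cmul y -> cmul (x - y).
Proof.
move=> [u Au <-] [v Av <-]; exists (u - v); first exact: idealB.
by rewrite rmulBr !opprD addrACA.
Qed.

Let cmulMl r x : cmul x -> cmul (r *r x).
Proof.
move=> [u Au <-]; exists (r *r u); first exact: idealMl.
by rewrite rmulBr !rmulA (boolrng_mulC e).
Qed.

Let cmulMr r x : cmul x -> cmul (x *r r).
Proof. by rewrite boolrng_mulC; exact: cmulMl. Qed.

Definition cmul_ideal : ideal P := Ideal cmul0 cmulB cmulMl cmulMr.
End PrincipalParts.

(* Main.v *)
Require Import Defs.
From mathcomp Require Import all_boot ssralg.
From mathcomp Require Import boolp classical_sets.

Set Implicit Arguments.
Unset Strict Implicit.
Unset Printing Implicit Defensive.

Import GRing.Theory.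
Local Open Scope ring_scope.

(** Write [T(R, o)] for [R] with the circle product [r + t + rt], and [B(A, B)]
    for [T(A, o) x T(B)].  Two facts give the theorem.

    Once the heap is based at [0 = (0, 0)], the truss [T(R, o) x T(S)] remembers
    both rings.  Its additive group is that of [R x S], and since
    [(r, s) . 0 = (r, 0)], the axes are definable: [R] consists of the [x] with
    [x . 0 = x], and [S] of the [x] with [x . 0 = 0].  On the second axis the
    truss product is the ring product; on the first it is [r + t + rt], from
    which [rt] is recovered by subtraction.  Hence a truss isomorphism taking
    [0] to [0] splits into ring isomorphisms of the factors
    ([pointed_truss_isom_rng]).

    On the other hand, basing the heap of [B(A, B)] at another point [(a, b)]
    only moves summands from one factor to the other.  By the Peirce
    decomposition, [A = (1 - a)A + aA] and [B = bB + (1 - b)B]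
    ([peirce_decomposition]).  In the Boolean rings [aA] and [bB], whose
    identities are [a] and [b], complementation exchanges join [x + y + xy] with
    meet [xy], so it exchanges [T(-, o)] with [T(-)], and it sends the identity
    to [0] ([complement_truss_isom]).  Complementing these two summands yields
    an isomorphism from [B(A, B)] to
    [T((1 - a)A x bB, o) x T(aA x (1 - b)B)] which sends [(a, b)] to [0]
    ([trussB_recentre]).

    Given an isomorphism [B(A, B) -> B(A', B')], let [(a, b)] be the preimage of
    [0]; comparing it with the recentred form of [B(A, B)] at [(a, b)] gives a
    pointed isomorphism, hence the two ring isomorphisms.  Conversely, the two
    ring isomorphisms identify the recentred form of [B(A, B)] with
    [B(A', B')]. *)

(** * Isomorphisms of trusses *)

(** The map is exposed, unlike in [truss_iso], because the argument depends on
    which point an isomorphism sends to [0]. *)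
Definition truss_isom (T U : trussType) (f : T -> U) : Prop :=
  [/\ bijective f,
      forall a b c, f [<| a, b, c |>] = [<| f a, f b, f c |>]
    & {morph f : a b / a *t b}].

Lemma truss_isom_id (T : trussType) : truss_isom (@id T).
Proof. by split=> //; exists id. Qed.

Lemma truss_isom_comp (T U V : trussType) (f : T -> U) (g : U -> V) :
  truss_isom f -> truss_isom g -> truss_isom (g \o f).
Proof.
move=> [fbij fH fM] [gbij gH gM].
by split=> [|a b c|a b] /=; [exact: bij_comp | rewrite fH gH | rewrite fM gM].
Qed.

Lemma truss_isom_inv (T U : trussType) (f : T -> U) :
  truss_isom f -> exists g, [/\ truss_isom g, cancel f g & cancel g f].
Proof.
move=> [[g fK gK] fH fM]; exists g; split=> //; split; first by exists f.
- by move=> a b c; rewrite -{1}(gK a) -{1}(gK b) -{1}(gK c) -fH fK.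
- by move=> a b; rewrite -{1}(gK a) -{1}(gK b) -fM fK.
Qed.

Lemma truss_isom_prod (T U V W : trussType) (f : T -> U) (g : V -> W) :
  truss_isom f -> truss_isom g ->
  truss_isom (fun x : T * V => (f x.1, g x.2)).
Proof.
move=> [[f' fK f'K] fH fM] [[g' gK g'K] gH gM]; split.
- by exists (fun x => (f' x.1, g' x.2)) => -[x y] /=; rewrite ?fK ?gK ?f'K ?g'K.
- by move=> a b c; congr (_, _); [exact: fH | exact: gH].
- by move=> a b; congr (_, _); [exact: fM | exact: gM].
Qed.

Lemma rng_isom_truss (R S : rngType) (f : R -> S) :
    bijective f -> {morph f : x y / x + y} -> {morph f : x y / x *r y} ->
  truss_isom (f : trussT R -> trussT S) /\
  truss_isom (f : trussTcirc R -> trussTcirc S).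
Proof.
move=> fbij fD fM.
have f0 : f 0 = 0 by apply: (addrI (f 0)); rewrite -fD !addr0.
have fN x : f (- x) = - f x by apply: (addrI (f x)); rewrite -fD !subrr.
have fH a b c : f (a - b + c) = f a - f b + f c by rewrite !fD fN.
split; split=> // a b.
by change (f (a + b + a *r b) = f a + f b + f a *r f b); rewrite !fD fM.
Qed.

Lemma trussTcirc_prod (R S : rngType) :
  truss_isom (id : trussTcirc (R * S)%type -> trussTcirc R * trussTcirc S).
Proof. by split=> //; exists id. Qed.

Lemma trussT_swap (R S : rngType) :
  truss_isom (fun x : trussT (R * S)%type =>
                (x.2, x.1) : trussT S * trussT R).
Proof. by split=> //; exists (fun x => (x.2, x.1)) => -[]. Qed.

(** The middle-four interchange: it collects the two factors carrying the circle
    product and the two carrying the ring product. *)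
Lemma truss_isom_rearrange (R1 R2 S1 S2 : rngType) :
  truss_isom
    (fun x : (trussTcirc R1 * trussT S1) * (trussTcirc R2 * trussT S2) =>
       ((x.1.1, x.2.1), (x.1.2, x.2.2))
       : trussTcirc (R1 * R2)%type * trussT (S1 * S2)%type).
Proof.
split=> //.
by exists (fun x => ((x.1.1, x.2.1), (x.1.2, x.2.2))) => -[[? ?] [? ?]].
Qed.

(** * Recovering the two rings from the pointed truss *)

(** The axes are cut out by right multiplication by [0], as
    [(r, s) . 0 = (r, 0)]: the equation [x . 0 = x] holds exactly on the first
    axis and [x . 0 = 0] exactly on the second, and a pointed morphism preserves
    both equations. *)
Lemma pointed_truss_axes (R S R' S' : rngType)
    (f : trussTcirc R * trussT S -> trussTcirc R' * trussT S') :
    {morph f : x y / x *t y} ->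
    f (0 : R, 0 : S) = (0 : R', 0 : S') ->
  (forall r : R, (f (r, 0 : S)).2 = 0 :> S') /\
  (forall s : S, (f (0 : R, s)).1 = 0 :> R').
Proof.
move=> fM f0.
have mul0 (Q Z : rngType) (x : trussTcirc Q * trussT Z) :
    x *t (0 : Q, 0 : Z) = (x.1, 0 : Z).
  case: x => q z; change ((q + 0 + q *r 0, z *r 0) = (q, 0 :> Z)).
  by rewrite !rmulr0 !addr0.
split=> [r|s].
- have := fM (r, 0 : S) (0 : R, 0 : S).
  by rewrite f0 !mul0 /= => {1}->.
- have := fM (0 : R, s) (0 : R, 0 : S).
  by rewrite f0 !mul0 /= f0 => -[].
Qed.

(** Sending [0] to [0] makes a heap morphism additive, and the axes are respected
    in both directions, so the isomorphism is a product of two maps. *)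
Lemma pointed_truss_isom_rng (R S R' S' : rngType)
    (f : trussTcirc R * trussT S -> trussTcirc R' * trussT S') :
    truss_isom f -> f (0 : R, 0 : S) = (0 : R', 0 : S') ->
  rng_iso R R' /\ rng_iso S S'.
Proof.
move=> fiso f0; have [g [[_ _ gM] fK gK]] := truss_isom_inv fiso.
have [_ fH fM] := fiso.
have g0 : g (0 : R', 0 : S') = (0 : R, 0 : S) by rewrite -f0 fK.
have [f2 f1] := pointed_truss_axes fM f0.
have [g2 g1] := pointed_truss_axes gM g0.
have fD (x y : R * S) : f (x + y) = (f x + f y : R' * S').
  transitivity (f (x - 0 + y : R * S)); first by rewrite subr0.
  rewrite (fH x (0, 0) y) f0.
  by change ((f x : R' * S') - 0 + f y = (f x : R' * S') + f y); rewrite subr0.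
have fR (r : R) : f (r, 0 : S) = ((f (r, 0 : S)).1, 0 : S').
  by rewrite -(f2 r); case: (f _).
have fS (s : S) : f (0 : R, s) = (0 : R', (f (0 : R, s)).2).
  by rewrite -(f1 s); case: (f _).
have gR (r : R') : g (r, 0 : S') = ((g (r, 0 : S')).1, 0 : S).
  by rewrite -(g2 r); case: (g _).
have gS (s : S') : g (0 : R', s) = (0 : R, (g (0 : R', s)).2).
  by rewrite -(g1 s); case: (g _).
have fRD (r t : R) :
    (f (r + t, 0 : S)).1 = (f (r, 0 : S)).1 + (f (t, 0 : S)).1 :> R'.
  have := fD (r, 0) (t, 0).
  by rewrite -[(r, 0) + (t, 0)]/(r + t, 0 + 0) addr0 => ->.
split.
- exists (fun r => (f (r, 0 : S)).1); split=> [|//|r t].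
    exists (fun r => (g (r, 0 : S')).1) => r.
      by rewrite -fR fK.
    by rewrite -gR gK.
  have /(congr1 fst) := fM (r, 0 : S) (t, 0 : S).
  have -> : ((r, 0 : S) : trussTcirc R * trussT S) *t (t, 0 : S)
      = (r + t + r *r t, 0 : S).
    by congr (_, _); exact: rmulr0.
  (* On the first axis the truss product is r + t + rt, so additivity leaves
     multiplicativity after cancelling r + t. *)
  rewrite !fRD => h.
  exact: (addrI _ h).
- exists (fun s => (f (0 : R, s)).2); split=> [|s t|s t].
  + exists (fun s => (g (0 : R', s)).2) => s.
      by rewrite -fS fK.
    by rewrite -gS gK.
  + have := fD (0, s) (0, t).
    by rewrite -[(0, s) + (0, t)]/(0 + 0, s + t) addr0 => ->.
  + have /(congr1 snd) := fM (0 : R, s) (0 : R, t).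
    have -> : ((0 : R, s) : trussTcirc R * trussT S) *t (0 : R, t)
        = (0 : R, s *r t).
      by congr (_, _); change ((0 : R) + 0 + 0 *r 0 = 0); rewrite rmulr0 !addr0.
    by [].
Qed.

(** * Splitting along an element of a Boolean ring *)

Lemma boolrng_addxx (P : boolRngType) (x : P) : x + x = 0.
Proof.
have := rmulxx (x + x); rewrite rmulDl !rmulDr !rmulxx => dx.
by apply: (addrI (x + x)); rewrite addr0.
Qed.

(** De Morgan duality: if [R] is Boolean, [xy] is the meet and [x + y + xy] the
    join of a Boolean algebra with top [u], and [u - x] is the complement of [x].
    Characteristic 2 matters: in general [u - x] carries [xy] to
    [x + y - xy]. *)
Lemma complement_truss_isom (R : rngType) (u : R) :
    (forall x : R, x + x = 0) ->
    (forall x, u *r x = x) -> (forall x, x *r u = x) ->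
  truss_isom ((fun x => u - x) : trussTcirc R -> trussT R) /\
  truss_isom ((fun x => u - x) : trussT R -> trussTcirc R).
Proof.
move=> dbl ul ur.
have opp (x : R) : - x = x by apply: (addrI x); rewrite subrr dbl.
have uK x : u - (u - x) = x by rewrite opprB addrC subrK.
have ubij : bijective (fun x => u - x) by exists (fun x => u - x).
have uH a b c : u - (a - b + c) = (u - a) - (u - b) + (u - c).
  rewrite !opp !addrA [RHS](+%R.[ACl 1 * 3 * 5 * 2 * 4 * 6]).
  by rewrite /= dbl add0r.
have uM a b : u - circ a b = (u - a) *r (u - b).
  rewrite /circ rmulBl !rmulBr !ul ur !opp !addrA.
  by rewrite [RHS](+%R.[ACl 1 * 3 * 2 * 4]).
split; split=> // a b.
change (u - a *r b = circ (u - a) (u - b)).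
by rewrite -[RHS]uK uM !uK.
Qed.

(** Multiplication by the central idempotent [a] and [x |-> x - ax] are the
    projections of [A] onto complementary ideals.  The projection of [a] onto
    [aA] is an identity there, even if [A] itself has none. *)
Lemma peirce_decomposition (P : boolRngType) (A : ideal P) (a : subrng A) :
  exists (f : subrng A ->
              (subrng (cmul_ideal (val a) A) * subrng (mul_ideal (val a) A))%type)
         (u : subrng (mul_ideal (val a) A)),
    [/\ bijective f, {morph f : x y / x + y}, {morph f : x y / x *r y},
        f a = (0, u) & forall x, u *r x = x].
Proof.
set e := val a.
have valA (x : subrng A) : (A : set P) (val x) := set_mem (valP x).
have mulP (x : subrng A) : ideal_pred (mul_ideal e A) (e *r val x).
  by apply: mem_set; exists (val x).
have cmulP (x : subrng A) : ideal_pred (cmul_ideal e A) (val x - e *r val x).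
  by apply: mem_set; exists (val x).
have sumP (x : subrng (cmul_ideal e A)) (y : subrng (mul_ideal e A)) :
    ideal_pred A (val x + val y).
  have [v Av <-] := set_mem (valP x); have [w Aw <-] := set_mem (valP y).
  apply: mem_set; rewrite -[e *r w]opprK; apply: idealB.
    by apply: idealB => //; exact: idealMl.
  by rewrite -rmulrN; apply: idealMl; rewrite -sub0r; apply: idealB => //;
    exact: ideal0.
have mulK (y : subrng (mul_ideal e A)) : e *r val y = val y.
  by have [w _ <-] := set_mem (valP y); rewrite rmulA rmulxx.
have cmulK (x : subrng (cmul_ideal e A)) : e *r val x = 0.
  by have [v _ <-] := set_mem (valP x); rewrite rmulBr rmulA rmulxx subrr.
pose f (x : subrng A) : subrng (cmul_ideal e A) * subrng (mul_ideal e A) :=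
  (Sub _ (cmulP x), Sub _ (mulP x)).
exists f, (Sub _ (mulP a)); split.
- exists (fun z => Sub _ (sumP z.1 z.2)) => [x|[x y]].
    by apply: val_inj; rewrite /= subrK.
  congr (_, _); apply: val_inj; rewrite /= rmulDr mulK cmulK add0r //.
  exact: addrK.
- move=> x y; congr (_, _); apply: val_inj; rewrite /= rmulDr //.
  by rewrite opprD addrACA.
- move=> x y; have eMM (z t : P) : e *r (z *r t) = (e *r z) *r (e *r t).
    by rewrite -rmulA (rmulA z) (boolrng_mulC z e) -rmulA [RHS]rmulA rmulxx.
  congr (_, _); apply: val_inj; rewrite /= ?eMM //.
  (* In the expansion of (x - ax)(y - ay), each product except xy is a(xy). *)
  rewrite rmulBl !rmulBr -eMM (rmulA (val x)) (boolrng_mulC (val x) e).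
  by rewrite -!rmulA subrr subr0.
- by congr (_, _); apply: val_inj; rewrite //= rmulxx subrr.
- by move=> x; apply: val_inj; rewrite /= rmulxx mulK.
Qed.

Lemma subrng_addxx (P : boolRngType) (A : ideal P) (x : subrng A) : x + x = 0.
Proof. by apply: val_inj; exact: boolrng_addxx. Qed.

Lemma subrng_mulC (P : boolRngType) (A : ideal P) : commutative (@rmul (subrng A)).
Proof. by move=> x y; apply: val_inj; exact: boolrng_mulC. Qed.

(** Complementing within [aA] turns [T(aA, o)] into [T(aA)] and moves the
    identity [a] of [aA] to [0]. *)
Lemma trussTcirc_split (P : boolRngType) (A : ideal P) (a : subrng A) :
  exists f : trussTcirc (subrng A) ->
      trussTcirc (subrng (cmul_ideal (val a) A)) *
      trussT (subrng (mul_ideal (val a) A)),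
    truss_isom f /\ f a = (0 : subrng _, 0 : subrng _).
Proof.
have [f [u [fbij fD fM fa ul]]] := peirce_decomposition a.
have ur x : x *r u = x by rewrite subrng_mulC.
have [_ fiso] := rng_isom_truss fbij fD fM.
have [uiso _] := complement_truss_isom (@subrng_addxx _ _) ul ur.
exists (fun x => ((f x).1, u - (f x).2)); split; last by rewrite fa /= subrr.
exact: truss_isom_comp (truss_isom_comp fiso (trussTcirc_prod _ _))
  (truss_isom_prod (truss_isom_id _) uiso).
Qed.

(** The mirror image of [trussTcirc_split]: [bB] is the summand complemented, so
    it passes from the ring product to the circle product. *)
Lemma trussT_split (P : boolRngType) (B : ideal P) (b : subrng B) :
  exists f : trussT (subrng B) ->
      trussTcirc (subrng (mul_ideal (val b) B)) *
      trussT (subrng (cmul_ideal (val b) B)),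
    truss_isom f /\ f b = (0 : subrng _, 0 : subrng _).
Proof.
have [f [u [fbij fD fM fb ul]]] := peirce_decomposition b.
have ur x : x *r u = x by rewrite subrng_mulC.
have [fiso _] := rng_isom_truss fbij fD fM.
have [_ uiso] := complement_truss_isom (@subrng_addxx _ _) ul ur.
exists (fun x => (u - (f x).2, (f x).1)); split; last by rewrite fb /= subrr.
exact: truss_isom_comp (truss_isom_comp fiso (trussT_swap _ _))
  (truss_isom_prod uiso (truss_isom_id _)).
Qed.

(** Changing the base point from [(0, 0)] to [(a, b)] swaps the summands [aA] and
    [bB] between the two factors. *)
Lemma trussB_recentre (P : boolRngType) (A B : ideal P)
    (a : subrng A) (b : subrng B) :
  exists f : trussB A B ->
      trussTcirc (subrng (cmul_ideal (val a) A) *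
                  subrng (mul_ideal (val b) B))%type *
      trussT (subrng (mul_ideal (val a) A) *
              subrng (cmul_ideal (val b) B))%type,
    truss_isom f /\
    f (a, b) = (0 : (subrng _ * subrng _)%type, 0 : (subrng _ * subrng _)%type).
Proof.
have [f [fiso fa]] := trussTcirc_split a.
have [g [giso gb]] := trussT_split b.
have h := truss_isom_comp (truss_isom_prod fiso giso)
  (truss_isom_rearrange _ _ _ _).
by eexists; split; [exact: h | rewrite /= fa gb].
Qed.

Theorem theorem3p12 (P : boolRngType) (A A' B B' : ideal P)
    (hAB : direct_sum A B) (hAB' : direct_sum A' B') :
  truss_iso (trussB A B) (trussB A' B') <->
  (exists a b : P,
    [/\ ideal_set A a, ideal_set B b,
        rng_iso (subrng A') (subrng (cmul_ideal a A) * subrng (mul_ideal b B))%type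
      & rng_iso (subrng B') (subrng (mul_ideal a A) * subrng (cmul_ideal b B))%type]).
Proof.
split=> [[f fiso] | [a [b [Aa Bb [f [fbij fD fM]] [g [gbij gD gM]]]]]].
- have [f' [f'iso _ _]] := truss_isom_inv fiso.
  case E: (f' (0 : subrng A', 0 : subrng B')) => [a b].
  have [h [hiso h0]] := trussB_recentre a b.
  have [] := pointed_truss_isom_rng (truss_isom_comp f'iso hiso).
    by rewrite /= E h0.
  exists (val a), (val b).
  by split=> //; [exact: set_mem (valP a) | exact: set_mem (valP b)].
- have [h [hiso _]] := trussB_recentre
    (Sub a (mem_set Aa) : subrng A) (Sub b (mem_set Bb) : subrng B).
  have [_ fiso] := rng_isom_truss fbij fD fM.
  have [giso _] := rng_isom_truss gbij gD gM.
  have [k [kiso _ _]] := truss_isom_inv (truss_isom_prod fiso giso).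
  by exists (k \o h); exact: truss_isom_comp hiso kiso.
Qed.
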